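(* Let $0<\alpha<1$, $1\le p<\frac1\alpha$ and let $x=\{x(k)\}_{k\in\mathbb{Z}}\subset\mathbb{R}$ be a sequence. (i) If $x\in l^p$, then the series $\sum_{i\neq k}\frac{x(i)}{|k-i|^{1-\alpha}}$ absolutely and uniformly converges on $\mathbb{Z}$. (ii) If $\frac1q=\frac1p-\alpha$, $q<2p$ and $x\in l^p_q$, then the series $\sum_{i\neq k}\frac{x(i)}{|k-i|^{1-\alpha}}$ absolutely and uniformly converges on $\mathbb{Z}$.
   Context: $\mathbb{N}=\{0,1,2,\dots\}$. For $m\in\mathbb{Z}$, $N\in\mathbb{N}$, $S_{m,N}:=\{k\in\mathbb{Z}:|k-m|\le N\}$ and $|S_{m,N}|=2N+1$ is its cardinality. $l^p$ is the space of real sequences $x$ on $\mathbb{Z}$ with $\|x\|_{l^p}:=\big(\sum_{k\in\mathbb{Z}}|x(k)|^p\big)^{1/p}<\infty$. The discrete Morrey space $l^p_q$ ($1\le p\le q<\infty$) is the set of real sequences $x=\{x(k)\}_{k\in\mathbb{Z}}$ with $$\|x\|_{l^p_q}:=\sup_{m\in\mathbb{Z},\,N\in\mathbb{N}}|S_{m,N}|^{\frac1q-\frac1p}\Big(\sum_{k\in S_{m,N}}|x(k)|^p\Big)^{\frac1p}<\infty .$$ In the series, $k\in\mathbb{Z}$ is the variable and the sum runs over all $i\in\mathbb{Z}\setminus\{k\}$; the series is the discrete Riesz potential $I_\alpha x(k)$. *)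

(* Defs.v *)
From HB Require Import structures.
From mathcomp Require Import all_boot all_order all_algebra.
From mathcomp Require Import finmap.
From mathcomp Require Import all_classical all_reals all_analysis.
From mathcomp Require summability.
From mathcomp Require Import zify.
Import Order.TTheory GRing.Theory Num.Theory numFieldNormedType.Exports.

Set Implicit Arguments.
Unset Strict Implicit.
Unset Printing Implicit Defensive.

Local Open Scope classical_set_scope.
Local Open Scope ring_scope.

Definition window (m : int) (N : nat) : set int := [set k | `|k - m| <= N%:Z].

(* Justifies both the finitely supported sum over [window m N] and the factor
   [N.*2.+1] in [morrey_norm]. *)
Lemma card_window (m : int) (N : nat) : (window m N #= `I_(N.*2.+1))%card.
Proof.
have -> : window m N = [set m - N%:Z + i%:Z | i in `I_(N.*2.+1)].
  apply/seteqP; split => [k|_ [i /= iN <-]]; rewrite /window /=; last by lia.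
  by move=> kN; exists `|(k - m + N%:Z)%R|%N => /=; lia.
by apply: inj_card_eq => i j _ _; lia.
Qed.

Section spaces.
Variable R : realType.
Implicit Types (p q : R) (x : int -> R).

Definition lp_norm p x : \bar R :=
  ((\esum_(k in [set: int]) (`|x k| `^ p)%:E) `^ p^-1)%E.

Definition lp p : set (int -> R) := [set x | (lp_norm p x < +oo)%E].

Definition morrey_norm p q x : \bar R :=
  ereal_sup (range (fun mN : int * nat =>
    ((mN.2.*2.+1)%:R `^ (q^-1 - p^-1) *
     (\sum_(k \in window mN.1 mN.2) `|x k| `^ p) `^ p^-1)%:E)).

Definition morrey p q : set (int -> R) :=
  [set x | (morrey_norm p q x < +oo)%E].

End spaces.

Section riesz.
Variable R : realType.
Implicit Types (alpha : R) (x : int -> R).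

(* The [i]-th term of the series at [k]; the excluded index [i = k] gets 0. *)
Definition riesz_term alpha x (k i : int) : R :=
  if i == k then 0 else x i / `|k - i|%:~R `^ (1 - alpha).

(* The partial sum at [k] over the indices [i = k + j], [j] in the finite set
   [J]: truncation is by the displacement [i - k], not by [i]. *)
Definition riesz_partial alpha x (J : {fset int}) (k : int) : R :=
  summability.partial_sum (fun j => riesz_term alpha x k (k + j)) J.

Definition riesz_abs_cvg alpha x : Prop :=
  forall k : int, summable [set i | i != k] (fun i => (riesz_term alpha x k i)%:E).

(* Uniform convergence in [k] of the unordered sum: the partial sums converge
   along the finite sets [J] ordered by inclusion. Indexing by displacement is
   essential for Morrey sequences: the indicator of the powers of 2 has finite
   Morrey norm (p < q), but for each [i = 2 ^ n] the term [x i / |k - i| ^ _]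
   equals 1 at [k = i + 1], so truncating at a set of [i] independent of [k] is
   never uniform. *)
Definition riesz_unif_cvg alpha x : Prop :=
  exists f : int -> R,
    {uniform, riesz_partial alpha x @ summability.totally --> f}.

End riesz.

(* Main.v *)
(* Both hypotheses give sum_{|k-m|<=N} |x(k)| <= C (2N+1)^(1-r) for all m, N,
   with r > alpha: r = 1/p for l^p, and r = 1/q for the Morrey space, where
   q < 2p says exactly that 1/q = 1/p - alpha exceeds alpha.  On the dyadic shell
   2^n <= |i-k| < 2^(n+1) the terms of the series at k then sum in absolute value
   to at most C' 2^(-n(1-alpha)) 2^(n(1-r)) = C' 2^(n(alpha-r)), a convergent
   geometric series whose tails do not depend on k. *)
Require Import Defs.
From mathcomp Require Import all_boot all_order all_algebra.
From mathcomp Require Import finmap.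
From mathcomp Require Import all_classical all_reals all_analysis.
From mathcomp Require Import zify ring lra.
From mathcomp Require summability.
Import Order.TTheory GRing.Theory Num.Theory numFieldNormedType.Exports.
Local Open Scope classical_set_scope.
Local Open Scope ring_scope.

(** * Sums over windows *)

Lemma ler_sum_sub_seq (R : numDomainType) (I : eqType) (s t : seq I)
    (P : pred I) (F : I -> R) :
    uniq s -> uniq t -> {in s, forall i, P i -> i \in t} ->
    (forall i, 0 <= F i) ->
  \sum_(i <- s | P i) F i <= \sum_(i <- t) F i.
Proof.
move=> us ut st F0; rewrite -big_filter.
have -> : \sum_(i <- [seq i <- s | P i]) F i =
          \sum_(i <- t | i \in [seq i <- s | P i]) F i.
  rewrite -[RHS]big_filter; apply: perm_big; apply: uniq_perm.
  - exact: filter_uniq.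
  - exact: filter_uniq.
  - move=> i; rewrite !mem_filter; case: (boolP (P i)) => //= Pi.
    by case: (boolP (i \in s)) => //= /st -> .
by rewrite big_mkcond; apply: ler_sum => i _; case: ifP.
Qed.

Lemma finite_window (m : int) (N : nat) : finite_set (window m N).
Proof. by exists N.*2.+1; exact: card_window. Qed.

(** Below the threshold [l] the first summand suffices. Above it [y / l >= 1], so
    [y / l <= (y / l) ^ p]; multiplying by [l] gives the second summand. *)
Lemma ler_add_powR (R : realType) (p l y : R) :
  1 <= p -> 0 < l -> 0 <= y -> y <= l + l `^ (1 - p) * y `^ p.
Proof.
move=> p1 l0 y0; have [yl|ly] := leP y l.
  by rewrite (le_trans yl)// lerDl mulr_ge0// powR_ge0.
have yl1 : 1 <= y / l by rewrite ler_pdivlMr// mul1r ltW.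
rewrite (le_trans _ (_ : l * (y / l) `^ p <= _))//.
- by rewrite -{1}(divfK (lt0r_neq0 l0) y) mulrC ler_pM2l// le1r_powR.
- rewrite powRM// ?invr_ge0 ?(ltW l0)// -[l^-1]powR_inv1 ?(ltW l0)//.
  rewrite -powRrM mulN1r powRD ?(lt0r_neq0 l0) ?implybT// powRr1 ?(ltW l0)//.
  by rewrite -mulrA (mulrC (y `^ p)) lerDr ltW.
Qed.

(* Replaces Hölder's inequality: sum [ler_add_powR] over the window with the
   threshold [l] equal to [(2N+1)^(-r)]. *)
Lemma window_sum_le (R : realType) (p r M : R) (x : int -> R) :
    1 <= p ->
    (forall m N, \sum_(k \in window m N) `|x k| `^ p <=
      M * N.*2.+1%:R `^ (1 - p * r)) ->
  forall m N, \sum_(k \in window m N) `|x k| <=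
    (1 + M) * N.*2.+1%:R `^ (1 - r).
Proof.
move=> p1 xM m N; set w : R := N.*2.+1%:R.
have w0 : 0 < w by rewrite ltr0n.
have wD a b : w `^ (a + b) = w `^ a * w `^ b.
  by rewrite powRD// (lt0r_neq0 w0) implybT.
(* This threshold balances the two parts: the constant one sums to [w * w ^ (- r)], the other to at
   most [w ^ (- r * (1 - p)) * M * w ^ (1 - p * r)], and both have exponent [1 - r]. *)
pose l := w `^ (- r).
apply: (le_trans (y := \sum_(k \in window m N)
    (l + l `^ (1 - p) * `|x k| `^ p))).
  rewrite !fsbig_finite; [|exact: finite_window..].
  by apply: ler_sum => k _; apply: ler_add_powR; rewrite ?powR_gt0.
rewrite fsbig_finite; last exact: finite_window.
rewrite big_split/= -mulr_sumr big_const_seq count_predT iter_addr_0.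
rewrite (card_fset_set (card_window m N)) mulrDl mul1r; apply: lerD.
  by rewrite wD (powRr1 (ltW w0)) -mulr_natl.
move: (xM m N); rewrite fsbig_finite; last exact: finite_window.
move=> /(ler_wpM2l (powR_ge0 l (1 - p))) /le_trans; apply.
rewrite mulrCA -/w /l -powRrM -wD.
by have -> : - r * (1 - p) + (1 - p * r) = 1 - r by ring.
Qed.

Lemma powR_exprn (R : realType) (b c : R) (n : nat) :
  0 <= b -> (b ^+ n) `^ c = (b `^ c) ^+ n.
Proof. by move=> b0; rewrite -powR_mulrn// powRAC powR_mulrn// powR_ge0. Qed.

(** * Estimates on dyadic shells of displacements *)

Section displacement.
Variables (R : realType) (alpha r C : R) (x : int -> R).
Hypotheses (alpha1 : alpha < 1) (alphar : alpha < r) (r1 : r <= 1).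
Hypothesis C0 : 0 <= C.
Hypothesis xC : forall m N,
  \sum_(k \in window m N) `|x k| <= C * N.*2.+1%:R `^ (1 - r).

Let term k j := `|riesz_term alpha x k (k + j)|.

Lemma riesz_block_le (k : int) (s : seq int) (n : nat) : uniq s ->
  \sum_(j <- s | (2 ^ n <= `|j| < 2 ^ n.+1)%N) term k j <=
  C * 8 `^ (1 - r) * (2 `^ (alpha - r)) ^+ n.
Proof.
move=> us; set b : R := 2 ^+ n.
have b0 : 0 < b by rewrite exprn_gt0.
(* As [alpha < 1], the kernel decreases with distance, so on the shell it is at most its value at
   the inner radius [b]. *)
apply: (le_trans (y := b `^ (alpha - 1) *
  \sum_(j <- s | (2 ^ n <= `|j| < 2 ^ n.+1)%N) `|x (k + j)|)).
  rewrite mulr_sumr; apply: ler_sum => j /andP[nj _].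
  have bj : b <= `|j|%:~R.
    by rewrite /b -natrX -[leLHS]/((Posz (2 ^ n))%:~R) ler_int; lia.
  rewrite /term /riesz_term; case: eqVneq => [|_].
    by rewrite normr0 mulr_ge0// powR_ge0.
  rewrite opprD addNKr normrN normrM mulrC ler_wpM2r// normfV.
  rewrite -[alpha - 1]opprB powRN ger0_norm ?powR_ge0// lef_pV2 ?posrE ?powR_gt0//.
    by apply: ge0_ler_powR; rewrite ?nnegrE ?subr_ge0 ?ler0z // ltW.
  exact: lt_le_trans bj.
have : \sum_(j <- s | (2 ^ n <= `|j| < 2 ^ n.+1)%N) `|x (k + j)| <=
       C * (8 * b) `^ (1 - r).
  apply: (le_trans (y := \sum_(i \in window k (2 ^ n.+1)) `|x i|)).
    rewrite fsbig_finite; last exact: finite_window.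
    have -> : \sum_(j <- s | (2 ^ n <= `|j| < 2 ^ n.+1)%N) `|x (k + j)| =
        \sum_(i <- [seq k + j | j <- s] |
          (2 ^ n <= `|(i - k)%R| < 2 ^ n.+1)%N) `|x i|.
      by rewrite big_map; apply: eq_bigl => j; rewrite addrC addKr.
    apply: ler_sum_sub_seq; rewrite ?fset_uniq ?(map_inj_uniq (addrI k))//.
    move=> i _ /andP[_ ik]; rewrite in_fset_set; last exact: finite_window.
    by rewrite inE /window /=; lia.
  rewrite (le_trans (xC _ _))// ler_wpM2l// ge0_ler_powR ?subr_ge0 ?nnegrE//.
    by rewrite mulr_ge0// ltW.
  (* Source of the 8: the window of radius [2 ^ n.+1] has [4 * 2 ^ n + 1 <= 8 * 2 ^ n] points. *)
  rewrite /b -natrX -natrM ler_nat expnS; have := expn_gt0 2 n; lia.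
move=> /(ler_wpM2l (powR_ge0 b (alpha - 1))) /le_trans; apply.
rewrite (powRM _ _ (ltW b0))// -powR_exprn// -/b.
have -> : alpha - r = (alpha - 1) + (1 - r) by ring.
rewrite [b `^ (_ + (1 - r))]powRD ?(lt0r_neq0 b0) ?implybT//.
by rewrite le_eqVlt; apply/orP; left; apply/eqP; ring.
Qed.

Let rho := 2 `^ (alpha - r).

Let rho_gt0 : 0 < rho.
Proof. exact: powR_gt0. Qed.

Let rho_lt1 : rho < 1.
Proof.
rewrite /rho -opprB powRN invf_lt1 ?powR_gt0//.
have : 1 `^ (r - alpha) < 2 `^ (r - alpha).
  by apply: gt0_ltr_powR; rewrite ?subr_gt0 ?nnegrE ?ler0n ?ltr1n.
by rewrite powR1.
Qed.

(** A finite list meets finitely many shells, so a partial geometric sum of shell bounds controls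
    it. The bound depends neither on [k] nor on [s], which serves both kinds of convergence. *)
Lemma riesz_tail_le (k : int) (s : seq int) (n : nat) : uniq s ->
  \sum_(j <- s | (2 ^ n <= `|j|)%N) term k j <=
  C * 8 `^ (1 - r) / (1 - rho) * rho ^+ n.
Proof.
move=> us; set D := C * 8 `^ (1 - r).
have D0 : 0 <= D by rewrite mulr_ge0// powR_ge0.
have partial N : \sum_(j <- s | (2 ^ n <= `|j| < 2 ^ (n + N))%N) term k j <=
    \sum_(n <= l < n + N) D * rho ^+ l.
  elim: N => [|N IH].
    by rewrite addn0 big_geq// big1// => j /andP[]; lia.
  rewrite addnS big_nat_recr ?leq_addr//=.
  (* Split off the outermost shell, where [riesz_block_le] applies. *)
  rewrite (bigID (fun j : int => (`|j| < 2 ^ (n + N))%N))/=.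
  apply: lerD.
    rewrite (le_trans _ IH)// le_eqVlt; apply/orP; left; apply/eqP.
    by apply: eq_bigl => j; rewrite expnS; lia.
  rewrite (le_trans _ (riesz_block_le k s (n + N)%N us))// le_eqVlt.
  apply/orP; left; apply/eqP; apply: eq_bigl => j.
  have := leq_pexp2l (isT : 0 < 2)%N (leq_addr N n); lia.
(* The largest [|j|] in [s] is a sufficient number of shells, since [|j| < 2 ^ |j|]. *)
have -> : \sum_(j <- s | (2 ^ n <= `|j|)%N) term k j =
    \sum_(j <- s | (2 ^ n <= `|j| < 2 ^ (n + \max_(j <- s) `|j|%N))%N) term k j.
  rewrite big_seq_cond [RHS]big_seq_cond; apply: eq_bigl => j.
  case: (boolP (j \in s)) => //= js; rewrite [X in _ = _ && X](_ : _ = true) ?andbT//.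
  apply: (leq_ltn_trans (@leq_bigmax_seq _ _ xpredT (fun j : int => `|j|%N) _ js isT)).
  by rewrite (leq_trans (ltn_expl _ (isT : 1 < 2)%N))// leq_pexp2l// leq_addl.
apply: (le_trans (partial _)).
rewrite -mulr_sumr geometric_partial_tail -mulrA ler_wpM2l//.
rewrite mulrC; apply: geometric_le_lim; rewrite ?exprn_ge0 ?ltW ?rho_gt0//.
by rewrite ger0_norm ?rho_lt1// ltW// rho_gt0.
Qed.

(** * Convergence from the tail bound *)

Lemma riesz_abs_cvg_window : riesz_abs_cvg alpha x.
Proof.
move=> k; rewrite /summable.
apply: (@le_lt_trans _ _ (C * 8 `^ (1 - r) / (1 - rho))%:E); last exact: ltry.
apply: ge_ereal_sup => _ [A [finA _] <-].
under eq_fsbigr do rewrite abse_EFin.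
rewrite fsumEFin// lee_fin fsbig_finite//.
(* For [n = 0] the tail condition reads [1 <= |i - k|]: it omits only [i = k], where the term is 0
   by convention. *)
have := @riesz_tail_le k [seq i - k | i <- fset_set A] 0.
rewrite map_inj_uniq; last exact: addIr.
rewrite fset_uniq mulr1 big_map => /(_ isT); apply: le_trans.
rewrite [leRHS]big_mkcond/=; apply: ler_sum => i _.
rewrite /term (addrC k) subrK; case: ifPn => // ik.
have -> : i = k by lia.
by rewrite /riesz_term eqxx normr0.
Qed.

(** The limit comes from completeness of the functions on the integers under the uniform structure,
    so only a Cauchy property is to be shown. *)
Lemma riesz_unif_cvg_window : riesz_unif_cvg alpha x.
Proof.
pose F := riesz_partial alpha x : {fset int} -> arrow_uniform_type int R.
pose totallyP := @summability.totally_filter int.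
suff : cauchy_ex (F @ summability.totally).
  move=> /(cauchy_exP (F @ summability.totally)) cF.
  have /cvg_ex[f Ff] : cvg (F @ summability.totally) by exact: cauchy_cvg.
  exists f => P.
  move=> /uniform_nbhs[E [entE EP]].
  have /cvg_fct_entourageP/(_ E entE) := Ff.
  by apply: filterS => J JE; apply: EP => y _; exact: JE.
move=> e e0.
pose D := C * 8 `^ (1 - r) / (1 - rho).
have /cvgr0Pnorm_lt : D * rho ^+ n @[n --> \oo] --> 0.
  rewrite -(mulr0 D); apply: cvgM; first exact: cvg_cst.
  by apply: cvg_expr; rewrite ger0_norm ?rho_lt1// ltW// rho_gt0.
move=> /(_ e e0) [n _ /(_ n (leqnn n)) /= De].
(* The predecessor turns the non-strict bound of [window] into [|j| < 2 ^ n], the complement of the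
   tail. *)
pose A := fset_set (window 0 (2 ^ n).-1).
have memA j : (j \in A) = (`|j| < 2 ^ n)%N.
  rewrite in_fset_set; last exact: finite_window.
  by apply/idP/idP; rewrite inE /window /=; have := expn_gt0 2 n; lia.
exists (F A); exists A => // J /= AJ k.
rewrite /F /ball /= /riesz_partial /summability.partial_sum.
rewrite -!(big_seq_fsetE _ _ xpredT (fun j => riesz_term alpha x k (k + j))).
have -> : \sum_(j <- A) riesz_term alpha x k (k + j) =
    \sum_(j <- J | (`|j| < 2 ^ n)%N) riesz_term alpha x k (k + j).
  rewrite -[RHS]big_filter; apply: perm_big; apply: uniq_perm => //.
  - by rewrite filter_uniq.
  - move=> j; rewrite mem_filter -memA.
    by case: (boolP (j \in A)) => //= /(fsubsetP AJ) ->.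
(* For [J] containing [A], the two partial sums differ exactly by the tail of [J]. *)
rewrite [X in _ - X](bigID (fun j : int => (`|j| < 2 ^ n)%N))/= opprD addNKr normrN.
apply: le_lt_trans De; apply: le_trans (ler_norm _).
apply: le_trans (riesz_tail_le k J n (fset_uniq J)).
apply: le_trans (ler_norm_sum _ _ _) _.
by under eq_bigl do rewrite -leqNgt.
Qed.

End displacement.

(** * Window bounds for the two spaces *)

Theorem proposition4p2 (R : realType) (alpha p : R) (x : int -> R)
    (halpha : 0 < alpha < 1) (hp : 1 <= p < 1 / alpha) :
  (lp p x -> riesz_abs_cvg alpha x /\ riesz_unif_cvg alpha x) /\
  (forall q : R, 1 / q = 1 / p - alpha -> q < 2 * p -> morrey p q x ->
     riesz_abs_cvg alpha x /\ riesz_unif_cvg alpha x).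
Proof.
have /andP[a0 a1] := halpha; have /andP[p1 pa] := hp.
have p0 : 0 < p by rewrite (lt_le_trans ltr01).
have key r M : alpha < r <= 1 -> 0 <= M ->
    (forall m N, \sum_(k \in window m N) `|x k| `^ p <=
      M * N.*2.+1%:R `^ (1 - p * r)) ->
    riesz_abs_cvg alpha x /\ riesz_unif_cvg alpha x.
  move=> /andP[ar r1] M0 /(window_sum_le _ _ _ _ _ p1) xM.
  have M10 : 0 <= 1 + M by rewrite addr_ge0.
  split; first exact: (riesz_abs_cvg_window _ _ _ _ _ a1 ar r1 M10 xM).
  exact: (riesz_unif_cvg_window _ _ _ _ _ a1 ar r1 M10 xM).
have ip1 : p^-1 <= 1 by rewrite invf_le1.
have ap : alpha < p^-1.
  by rewrite -div1r ltr_pdivlMr// mulrC -ltr_pdivlMr.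
split=> [xp|q].
- pose S := \esum_(k in [set: int]) (`|x k| `^ p)%:E.
  have S0 : (0 <= S)%E by apply: esum_ge0 => k _; rewrite lee_fin powR_ge0.
  have Sfin : S \is a fin_num.
    rewrite ge0_fin_numE//; apply: (lty_poweRy _ xp).
    by rewrite invr_neq0// lt0r_neq0.
  apply: (key p^-1 (fine S)); rewrite ?ap ?fine_ge0// => m N.
  (* With [r = 1 / p] the window factor has exponent 0, so it remains to bound a window sum by the
     full sum. *)
  rewrite divff ?lt0r_neq0// subrr powRr0 mulr1 -lee_fin fineK//.
  rewrite -fsumEFin; last exact: finite_window.
  by apply: ereal_sup_ubound; exists (window m N) => //; split=> //;
    exact: finite_window.
- rewrite !div1r => qE q2p xpq.
  have iq0 : 0 < q^-1 by rewrite qE subr_gt0.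
  have q0 : 0 < q by rewrite -invr_gt0.
  (* From [1 / (2 * p) < 1 / q = 1 / p - alpha] follows [alpha < 1 / (2 * p) < 1 / q]. *)
  have aq : alpha < q^-1.
    have : (2 * p)^-1 < q^-1 by rewrite ltf_pV2 ?posrE ?mulr_gt0.
    rewrite invfM qE; lra.
  pose K := fine (morrey_norm p q x).
  have le_K m N : N.*2.+1%:R `^ (q^-1 - p^-1) *
      (\sum_(k \in window m N) `|x k| `^ p) `^ p^-1 <= K.
    have xmN : (((N.*2.+1)%:R `^ (q^-1 - p^-1) *
        (\sum_(k \in window m N) `|x k| `^ p) `^ p^-1)%:E <= morrey_norm p q x)%E.
      by apply: ereal_sup_ubound; exists (m, N).
    rewrite -lee_fin fineK//; rewrite ge0_fin_numE//.
    by rewrite (le_trans _ xmN)// lee_fin mulr_ge0// powR_ge0.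
  have K0 : 0 <= K by rewrite (le_trans _ (le_K 0 0%N))// mulr_ge0// powR_ge0.
  apply: (key q^-1 (K `^ p)); rewrite ?powR_ge0 ?aq//=.
    by rewrite qE; lra.
  move=> m N; set w : R := N.*2.+1%:R; set s := \sum_(k \in _) _.
  have w0 : 0 < w by rewrite ltr0n.
  have s0 : 0 <= s by apply: fsumr_ge0 => k _; exact: powR_ge0.
  (* Raise the Morrey bound to the power [p], then multiply by [w ^ (1 - p / q)]: the powers of [w]
     cancel on the left, leaving the window sum [s]. *)
  have := ge0_ler_powR (ltW p0) _ _ (le_K m N).
  rewrite !nnegrE mulr_ge0 ?powR_ge0// => /(_ isT K0).
  rewrite powRM ?powR_ge0// -!powRrM mulVf ?lt0r_neq0// powRr1//.
  move=> /(ler_wpM2r (powR_ge0 w (1 - p * q^-1))); apply: le_trans.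
  rewrite mulrAC -powRD ?(lt0r_neq0 w0) ?implybT//.
  have -> : (q^-1 - p^-1) * p + (1 - p * q^-1) = 0.
    by rewrite mulrBl mulVf ?lt0r_neq0//; ring.
  by rewrite powRr0 mul1r.
Qed.
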